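(* There exist absolute constants $C_1,C_2>0$ such that the following holds. Let $(p_1,y_1),\ldots,(p_T,y_T)\in[0,1]\times\{0,1\}$ be an arbitrary sequence and let $\mathcal D$ be the uniform distribution over these pairs. Let $m\in\{2^1,2^2,\ldots\}$ with $\mathsf{SCDL}(\mathcal D)<2/m$, and let $\delta\in(0,1/(2m))$ with $\frac1m\ge C_1\sqrt{\log(1/\delta)/T}$. For each $t$, independently round $p_t$ to $p_t'\sim\tau_m(p_t)$, and let $\mathcal D'$ be the uniform distribution over $(p_1',y_1),\ldots,(p_T',y_T)$. Then with probability at least $1-\delta$, $$\sup_Z\mathsf{SR}_Z(r_Z^*,\mathcal D')\le 2\,\mathsf{SCDL}(\mathcal D)+\frac2m+C_2\sqrt{\frac{\log(1/\delta)}{T}}\cdot\log m,$$ where the supremum is over all decision tasks $Z=(A,U)$ with $U:A\times\{0,1\}\to[0,1]$.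
   Context: For $x\in\mathbb R$ write $x_+=\max\{x,0\}$. For a positive integer $m$ let $G_m=\{0,1/m,\ldots,1\}$, and for $i\in\{0,\ldots,m\}$ let $w_i(p)=(1-|mp-i|)_+$. The randomized rounding $\tau_m(p)$ is the distribution on $G_m$ with $\Pr[p'=i/m]=w_i(p)$ (so $\mathbb E[p'\mid p]=p$). For a distribution $\mathcal D$ on $[0,1]\times\{0,1\}$ let $\pi_i=\mathbb E_{\mathcal D}[w_i(p)]$, $q_i=\mathbb E_{\mathcal D}[w_i(p)y]/\pi_i$ (terms with $\pi_i=0$ are $0$), $$\mathsf{SCDL}_m(\mathcal D)=\max_{i=0,\ldots,m}\Big(\sum_{j=0}^{i}\pi_j\big(q_j-\tfrac{i+1}{m}\big)_+ +\sum_{j=i+1}^{m}\pi_j\big(\tfrac im-q_j\big)_+\Big),\quad \mathsf{SCDL}(\mathcal D)=\inf_{m\in\{2^1,2^2,\ldots\}}\max\{\mathsf{SCDL}_m(\mathcal D),1/m\}.$$ A decision task $Z=(A,U)$ has action set $A$ and utility $U:A\times\{0,1\}\to[0,1]$; its best-response function is $r_Z^*(p)\in\arg\max_{a\in A}\mathbb E_{y\sim\mathsf{Ber}(p)}U(a,y)$. The swap regret of a response $r$ is $\mathsf{SR}_Z(r,\mathcal D)=\sup_{\sigma:A\to A}\mathbb E_{(p,y)\sim\mathcal D}[U(\sigma(r(p)),y)-U(r(p),y)]$. *)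

(* Defs.v *)
From HB Require Import structures.
From mathcomp Require Import all_boot all_order all_algebra.
From mathcomp Require Import all_classical all_reals.
From mathcomp Require Import exp.
Set Implicit Arguments. Unset Strict Implicit. Unset Printing Implicit Defensive.
Import Order.TTheory GRing.Theory Num.Theory.
Local Open Scope ring_scope.
Local Open Scope classical_set_scope.

Section Defs.
Variable R : realType.

Definition posp (x : R) : R := Num.max x 0.

Definition wgt (m i : nat) (p : R) : R := posp (1 - `|m%:R * p - i%:R|).

Definition Emp (T : nat) (p : 'I_T -> R) (y : 'I_T -> bool)
  (f : R -> bool -> R) : R := T%:R^-1 * \sum_(t < T) f (p t) (y t).

Definition pi_ (T : nat) (p : 'I_T -> R) (y : 'I_T -> bool) (m i : nat) : R :=
  Emp p y (fun q _ => wgt m i q).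

Definition q_ (T : nat) (p : 'I_T -> R) (y : 'I_T -> bool) (m i : nat) : R :=
  if pi_ p y m i == 0 then 0
  else Emp p y (fun q b => wgt m i q * (b : nat)%:R) / pi_ p y m i.

(* SCDL_m: maximum over i = 0..m (all terms are nonnegative, so 0 is a
   harmless neutral element for the iterated max). *)
Definition SCDLm (T : nat) (p : 'I_T -> R) (y : 'I_T -> bool) (m : nat) : R :=
  \big[Num.max/0]_(i < m.+1)
    (\sum_(j < m.+1 | (j <= i)%N)
        pi_ p y m j * posp (q_ p y m j - (i.+1)%:R / m%:R)
   + \sum_(j < m.+1 | (i < j)%N)
        pi_ p y m j * posp (i%:R / m%:R - q_ p y m j)).

Definition SCDL (T : nat) (p : 'I_T -> R) (y : 'I_T -> bool) : R :=
  inf [set x | exists k : nat, (0 < k)%N /\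
         x = Num.max (SCDLm p y (2 ^ k)%N) ((2 ^ k)%:R)^-1].

(* Randomized rounding tau_m applied independently to each p_t:
   an outcome is o : {ffun 'I_T -> 'I_m.+1}, meaning p'_t = (o t)/m,
   and it has probability prod_t w_{o t}(p_t). *)
Definition round_prob (T m : nat) (p : 'I_T -> R) (o : {ffun 'I_T -> 'I_m.+1}) : R :=
  \prod_(t < T) wgt m (o t) (p t).

Definition Prob (T m : nat) (p : 'I_T -> R) (E : {ffun 'I_T -> 'I_m.+1} -> Prop) : R :=
  \sum_(o : {ffun 'I_T -> 'I_m.+1} | `[< E o >]) round_prob p o.

Definition rounded (T m : nat) (o : {ffun 'I_T -> 'I_m.+1}) : 'I_T -> R :=
  fun t => (o t)%:R / m%:R.

Definition utility_ok (A : Type) (U : A -> bool -> R) : Prop :=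
  forall a b, 0 <= U a b <= 1.

Definition exp_util (A : Type) (U : A -> bool -> R) (a : A) (p : R) : R :=
  (1 - p) * U a false + p * U a true.

Definition best_response (A : Type) (U : A -> bool -> R) (r : R -> A) : Prop :=
  forall q, 0 <= q <= 1 -> forall a, exp_util U a q <= exp_util U (r q) q.

Definition SR (A : Type) (U : A -> bool -> R) (r : R -> A)
  (T : nat) (p : 'I_T -> R) (y : 'I_T -> bool) : R :=
  sup [set x | exists sigma : A -> A,
         x = Emp p y (fun q b => U (sigma (r q)) b - U (r q) b)].

End Defs.
Arguments rounded {R T m}.

(* Main.v *)
(* After rounding, the predictions lie on the grid {i/m}, where the swap regret of a best response
   is a mixture, of total mass at most 2, of V-shaped regrets with kinks in the cells
   [i/m, (i+1)/m]; hence it is at most 2 SCDL_m(D') + 2/m.  Refining the grid only increases SCDL_m,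
   and SCDL(D) < 2/m rules out the coarser grids in the infimum, so SCDL_m(D) <= SCDL(D) < 2/m.

   It remains to compare SCDL_m(D') with SCDL_m(D).  Put eps = sqrt(log(1/delta)/T).  By a Chernoff
   bound, the bias pi_j (q_j - v) of every cell moves by O(sqrt(pi_j) eps + eps^2).  Summing this
   over j would lose a factor sqrt m, so the cells are grouped by their distance to the cutoff into
   dyadic scales.  At scale D/m a cell is either roughly calibrated, and then its bias -pi_j D/m
   absorbs the fluctuation up to eps^2 m/D by AM-GM; or it is miscalibrated by about D/m, and then
   the loss at a shifted cutoff, which is at most 2/m, shows that such cells have total mass O(1/D),
   so that sqrt(pi_j) sums to O(1) over them.  Either way a scale costs O(eps), and there are
   about log m scales. *)
Require Import Defs.
From HB Require Import structures.
From mathcomp Require Import all_boot all_order all_algebra.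
From mathcomp Require Import all_classical all_reals.
From mathcomp Require Import Rstruct sequences exp.
From mathcomp Require Import ring lra zify.
Import Order.TTheory GRing.Theory Num.Theory.
Local Open Scope ring_scope.

Set Implicit Arguments. Unset Strict Implicit. Unset Printing Implicit Defensive.

(** * Refining the grid *)

Lemma posp_ge0 (R : realType) (x : R) : 0 <= posp x.
Proof. by rewrite /posp le_max lexx orbT. Qed.

Lemma posp_ge (R : realType) (x : R) : x <= posp x.
Proof. by rewrite /posp le_max lexx. Qed.

Lemma posp_le_iff (R : realType) (x z : R) : (posp x <= z) = (x <= z) && (0 <= z).
Proof. by rewrite /posp ge_max. Qed.

Lemma ler_posp (R : realType) (x y : R) : x <= y -> posp x <= posp y.
Proof. by move=> h; rewrite posp_le_iff posp_ge0 (le_trans h (posp_ge y)). Qed.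

Lemma ler_pospD (R : realType) (x y : R) : posp (x + y) <= posp x + posp y.
Proof. by rewrite posp_le_iff lerD ?posp_ge // addr_ge0 ?posp_ge0. Qed.

Lemma pospM (R : realType) (c x : R) : 0 <= c -> c * posp x = posp (c * x).
Proof. by move=> c0; rewrite /posp maxr_pMr // mulr0. Qed.

Lemma posp_id (R : realType) (x : R) : 0 <= x -> posp x = x.
Proof. by move=> x0; apply/max_idPl. Qed.

Lemma posp_eq0 (R : realType) (x : R) : x <= 0 -> posp x = 0.
Proof. by move=> x0; apply/max_idPr. Qed.

Lemma wgt_ge0 (R : realType) m i (p : R) : 0 <= wgt m i p.
Proof. exact: posp_ge0. Qed.

(** The right-hand side also covers points beyond the last node, so that the induction on [m]
    closes; it equals 1 as soon as [x <= m]. *)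
Lemma sum_hat (R : realType) (m : nat) (x : R) : 0 <= x ->
  \sum_(i < m.+1) posp (1 - `|x - i%:R|) = Num.min 1 (posp (m%:R + 1 - x)).
Proof.
move=> x0; elim: m => [|m IH].
  rewrite big_ord_recl big_ord0 addr0 subr0 ger0_norm // add0r.
  by rewrite /posp; case: (leP _ 0) => h; rewrite /Order.min; case: ifP => h'; lra.
rewrite big_ord_recr /= IH -natr1.
have m0 : 0 <= m%:R :> R by [].
have [h|h] := leP (x - (m%:R + 1)) 0.
  rewrite (ler0_norm h) (@posp_id _ (m%:R + 1 - x)); last by lra.
  rewrite (@posp_id _ (m%:R + 1 + 1 - x)); last by lra.
  by rewrite /posp; case: (leP _ 0) => h1; rewrite /Order.min; repeat (case: ifP => ?); lra.
rewrite (gtr0_norm h) (@posp_eq0 _ (m%:R + 1 - x)); last by lra.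
rewrite /posp; case: (leP _ 0) => h1; case: (leP _ 0) => h2; rewrite /Order.min; repeat (case: ifP => ?); lra.
Qed.

Lemma sum_wgt (R : realType) (m : nat) (p : R) : 0 <= p <= 1 ->
  \sum_(i < m.+1) wgt m i p = 1.
Proof.
move=> /andP[p0 p1]; rewrite sum_hat; last exact: mulr_ge0.
have h : m%:R * p <= m%:R by rewrite ler_piMr.
by rewrite posp_id; [apply/min_idPl; lra | lra].
Qed.

(** The two-scale relation of piecewise linear interpolation. By symmetry [x] may be taken
    nonnegative, and then the hat centred at -1/2 vanishes. *)
Lemma hat_refine (R : realType) (x : R) :
  posp (1 - `|x|) = posp (1 - `|2 * x|) + posp (1 - `|2 * x - 1|) / 2
    + posp (1 - `|2 * x + 1|) / 2.
Proof.
wlog x0 : x / 0 <= x => [H|].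
  have [|x0] := leP 0 x; first exact: H.
  have := H (- x); rewrite normrN.
  rewrite (_ : `|2 * - x| = `|2 * x|); last by rewrite -normrN; congr Num.norm; ring.
  rewrite (_ : `|2 * - x - 1| = `|2 * x + 1|); last by rewrite -normrN; congr Num.norm; ring.
  rewrite (_ : `|2 * - x + 1| = `|2 * x - 1|); last by rewrite -normrN; congr Num.norm; ring.
  by move=> ->; [ring | lra].
rewrite (ger0_norm x0) ger0_norm; last by lra.
rewrite [`|2 * x + 1|]ger0_norm; last by lra.
rewrite [X in _ + X / 2]posp_eq0 ?mul0r ?addr0; last by lra.
have [h|h] := leP (2 * x) 1.
  by rewrite ler0_norm ?posp_id; lra.
rewrite ger0_norm; last by lra.
rewrite [posp (1 - 2 * x)]posp_eq0; last by lra.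
have [h1|h1] := leP x 1; first by rewrite !posp_id; lra.
by rewrite !posp_eq0; lra.
Qed.

(** Cell 0 has no left neighbour on the fine grid; the hat that would sit there vanishes on
    [p >= 0]. *)
Lemma wgt_refine (R : realType) (m i : nat) (p : R) : 0 <= p ->
  wgt m i p = wgt (2 * m)%N (2 * i)%N p + wgt (2 * m)%N (2 * i).+1%N p / 2
    + (if i is i'.+1 then wgt (2 * m)%N (2 * i').+1%N p / 2 else 0).
Proof.
move=> p0; have -> : (if i is i'.+1 then wgt (2 * m)%N (2 * i').+1%N p / 2 else 0)
    = posp (1 - `|2 * (m%:R * p - i%:R) + 1|) / 2.
  case: i => [|i].
    have mp0 : 0 <= m%:R * p by exact: mulr_ge0.
    by rewrite subr0 ger0_norm ?posp_eq0 ?mul0r //; lra.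
  by rewrite /wgt; congr (posp (1 - `| _ |) / 2); rewrite -!natr1 !natrM; ring.
rewrite /wgt -(@natr1 _ (2 * i)%N) !natrM.
have -> : 2 * m%:R * p - 2 * i%:R = 2 * (m%:R * p - i%:R) by ring.
have -> : 2 * m%:R * p - (2 * i%:R + 1) = 2 * (m%:R * p - i%:R) - 1 by ring.
exact: hat_refine.
Qed.

Lemma EmpD (R : realType) T (p : 'I_T -> R) y f g :
  Emp p y (fun q b => f q b + g q b) = Emp p y f + Emp p y g.
Proof. by rewrite /Emp big_split mulrDr. Qed.

Lemma EmpZ (R : realType) T (p : 'I_T -> R) y c f :
  Emp p y (fun q b => c * f q b) = c * Emp p y f.
Proof. by rewrite /Emp -mulr_sumr mulrCA. Qed.

Lemma eq_Emp (R : realType) T (p : 'I_T -> R) y f g :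
  (forall t, f (p t) (y t) = g (p t) (y t)) -> Emp p y f = Emp p y g.
Proof. by move=> h; rewrite /Emp (eq_bigr _ (fun t _ => h t)). Qed.

Lemma ler_Emp (R : realType) T (p : 'I_T -> R) y f g :
  (forall t, f (p t) (y t) <= g (p t) (y t)) -> Emp p y f <= Emp p y g.
Proof. by move=> h; rewrite /Emp ler_wpM2l ?invr_ge0 // ler_sum. Qed.

Lemma Emp0 (R : realType) T (p : 'I_T -> R) y : Emp p y (fun _ _ => 0) = 0.
Proof. by rewrite /Emp big1 ?mulr0. Qed.

(* [bias v m j = pi_j * (q_j - v)], which is meaningful also when [pi_j = 0]. *)
Definition bias (R : realType) T (p : 'I_T -> R) y (v : R) (m j : nat) : R :=
  Emp p y (fun q b => wgt m j q * ((b : nat)%:R - v)).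

Lemma pi_ge0 (R : realType) T (p : 'I_T -> R) y m j : 0 <= pi_ p y m j.
Proof. by rewrite -(Emp0 p y); apply: ler_Emp => t; exact: wgt_ge0. Qed.

(** When [pi_j = 0], the numerator of [q_j] is squeezed to 0 as well, so the default value of [q_]
    does no harm. *)
Lemma pi_qE (R : realType) T (p : 'I_T -> R) y m j v :
  pi_ p y m j * (q_ p y m j - v) = bias p y v m j.
Proof.
have -> : bias p y v m j = Emp p y (fun q b => wgt m j q * (b : nat)%:R) - v * pi_ p y m j.
  by rewrite -mulNr -EmpZ -EmpD; apply: eq_Emp => t; ring.
rewrite mulrBr (mulrC v); congr (_ - _); rewrite /q_; case: eqP => [h|/eqP h]; last by field.
rewrite mulr0; apply/eqP; rewrite eq_sym eq_le; apply/andP; split.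
  by rewrite -h; apply: ler_Emp => t; case: (y t); rewrite ?mulr1 ?mulr0 ?wgt_ge0.
by rewrite -(Emp0 p y); apply: ler_Emp => t; rewrite mulr_ge0 ?wgt_ge0.
Qed.

(** The quantity maximised in [SCDLm], with the masses moved inside the positive parts: what stands
    there is then linear in the cell weights, so it can be refined and compared cell by cell. *)
Definition cutoff_loss (R : realType) T (p : 'I_T -> R) y (m i : nat) : R :=
  \sum_(0 <= j < i.+1) posp (bias p y (i.+1%:R / m%:R) m j)
  + \sum_(i.+1 <= j < m.+1) posp (- bias p y (i%:R / m%:R) m j).

Lemma SCDLmE (R : realType) T (p : 'I_T -> R) y m :
  SCDLm p y m = \big[Num.max/0]_(i < m.+1) cutoff_loss p y m i.
Proof.
apply: eq_bigr => i _; rewrite /cutoff_loss; congr (_ + _).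
  rewrite -(big_mkord (fun j => (j <= i)%N)
    (fun j => pi_ p y m j * posp (q_ p y m j - i.+1%:R / m%:R))).
  rewrite (@big_cat_nat _ _ _ i.+1) //=.
  rewrite [X in _ + X]big_nat_cond [X in _ + X]big1 ?addr0; last by lia.
  rewrite big_nat_cond [RHS]big_nat_cond; apply: eq_big => j; first by lia.
  by move=> _; rewrite pospM ?pi_ge0 // pi_qE.
rewrite -(big_mkord (fun j => (i < j)%N)
  (fun j => pi_ p y m j * posp (i%:R / m%:R - q_ p y m j))).
rewrite (@big_cat_nat _ _ _ i.+1) //=.
rewrite [X in X + _]big_nat_cond [X in X + _]big1 ?add0r; last by lia.
rewrite big_nat_cond [RHS]big_nat_cond; apply: eq_big => j; first by lia.
by move=> _; rewrite pospM ?pi_ge0 // -[_ / _ - _]opprB mulrN pi_qE.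
Qed.

Lemma cutoff_loss_le (R : realType) T (p : 'I_T -> R) y m i : (i <= m)%N ->
  cutoff_loss p y m i <= SCDLm p y m.
Proof.
rewrite SCDLmE -ltnS => im.
exact: (@le_bigmax_cond _ _ _ 0 (Ordinal im) xpredT (fun j : 'I_m.+1 => cutoff_loss p y m j)).
Qed.

Lemma ler_bias (R : realType) T (p : 'I_T -> R) y v v' m j : v <= v' ->
  bias p y v' m j <= bias p y v m j.
Proof. by move=> h; apply: ler_Emp => t; rewrite ler_wpM2l ?wgt_ge0 // lerD2l lerN2. Qed.

Lemma bias_refine (R : realType) T (p : 'I_T -> R) y v m j :
  (forall t, 0 <= p t <= 1) ->
  bias p y v m j = bias p y v (2 * m)%N (2 * j)%N + bias p y v (2 * m)%N (2 * j).+1%N / 2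
    + (if j is j'.+1 then bias p y v (2 * m)%N (2 * j').+1%N / 2 else 0).
Proof.
move=> hp; have hp0 t : 0 <= p t by case/andP: (hp t).
have E3 (f g h : R -> bool -> R) :
    Emp p y f + Emp p y g / 2 + Emp p y h / 2
    = Emp p y (fun q b => f q b + 2^-1 * g q b + 2^-1 * h q b).
  by rewrite !EmpD !EmpZ; ring.
rewrite /bias; case: j => [|j].
  rewrite -[X in _ = _ + X](mul0r 2^-1) -[X in _ = _ + X * _](Emp0 p y) E3.
  by apply: eq_Emp => t; rewrite (wgt_refine _ _ (hp0 t)); ring.
by rewrite E3; apply: eq_Emp => t; rewrite (wgt_refine _ _ (hp0 t)); ring.
Qed.

(** Each odd fine cell is split in halves between its two coarse neighbours. The halves recombine
    except at the right end, where the other half of cell [2n+1] belongs to coarse cell [n+1]. *)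
Lemma sum_refine (R : realType) (P : nat -> R) n :
  \sum_(0 <= j < n.+1) (P (2 * j)%N + P (2 * j).+1%N / 2
    + (if j is j'.+1 then P (2 * j').+1%N / 2 else 0))
  = \sum_(0 <= j < (2 * n).+1) P j + P (2 * n).+1%N / 2.
Proof.
elim: n => [|n IH]; first by rewrite !big_nat1 addr0.
rewrite big_nat_recr //= IH mulnS !addSn add0n.
by rewrite (@big_nat_recr _ _ _ (2 * n).+2 0) //= (@big_nat_recr _ _ _ (2 * n).+1 0) //=; lra.
Qed.

Lemma posp_bias_refine (R : realType) T (p : 'I_T -> R) y v m j :
  (forall t, 0 <= p t <= 1) ->
  posp (bias p y v m j) <=
  posp (bias p y v (2 * m)%N (2 * j)%N) + posp (bias p y v (2 * m)%N (2 * j).+1%N) / 2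
    + (if j is j'.+1 then posp (bias p y v (2 * m)%N (2 * j').+1%N) / 2 else 0).
Proof.
move=> hp; rewrite (bias_refine _ _ _ _ hp).
have half (x : R) : posp (x / 2) = posp x / 2 by rewrite mulrC -pospM ?invr_ge0 // mulrC.
case: j => [|j]; rewrite ?addr0 -?half; first exact: ler_pospD.
by apply: le_trans (ler_pospD _ _) _; rewrite lerD2r ler_pospD.
Qed.

Lemma posp_biasN_refine (R : realType) T (p : 'I_T -> R) y v m j :
  (forall t, 0 <= p t <= 1) ->
  posp (- bias p y v m j) <=
  posp (- bias p y v (2 * m)%N (2 * j)%N) + posp (- bias p y v (2 * m)%N (2 * j).+1%N) / 2
    + (if j is j'.+1 then posp (- bias p y v (2 * m)%N (2 * j').+1%N) / 2 else 0).
Proof.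
move=> hp; rewrite (bias_refine _ _ _ _ hp).
have half (x : R) : posp (- (x / 2)) = posp (- x) / 2.
  by rewrite -mulNr mulrC -pospM ?invr_ge0 // mulrC.
case: j => [|j]; rewrite ?addr0 -?half !opprD; first exact: ler_pospD.
by apply: le_trans (ler_pospD _ _) _; rewrite lerD2r ler_pospD.
Qed.

Lemma wgt_above (R : realType) (m i : nat) (p : R) : 0 <= p <= 1 -> (m < i)%N ->
  wgt m i p = 0.
Proof.
move=> /andP[p0 p1] mi; apply: posp_eq0.
have : m%:R + 1 <= i%:R :> R by rewrite natr1 ler_nat.
have h : m%:R * p <= m%:R by rewrite ler_piMr.
by move=> ?; rewrite ler0_norm; lra.
Qed.

(** At cutoff [m] no cell lies above, and the threshold [(m+1)/m] for the cells below exceeds every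
    label. *)
Lemma cutoff_loss_last (R : realType) T (p : 'I_T -> R) y m : (0 < m)%N ->
  cutoff_loss p y m m = 0.
Proof.
move=> m0; rewrite /cutoff_loss [X in _ + X]big_geq // addr0 big1 // => j _.
apply: posp_eq0; rewrite -(Emp0 p y); apply: ler_Emp => t.
rewrite mulr_ge0_le0 ?wgt_ge0 // subr_le0.
have : 1 <= m.+1%:R / m%:R :> R by rewrite ler_pdivlMr ?ltr0n // mul1r ler_nat.
by apply: le_trans; rewrite lern1 leq_b1.
Qed.

(* The coarse cutoff [i] is the average of the fine cutoffs [2i] and [2i+1]: the fine cell [2i+1],
   which is shared by the coarse cells [i] and [i+1], counts half on either side. *)
Lemma cutoff_loss_double (R : realType) T (p : 'I_T -> R) y m i :
  (forall t, 0 <= p t <= 1) -> (i < m)%N ->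
  cutoff_loss p y m i <=
  (cutoff_loss p y (2 * m)%N (2 * i)%N + cutoff_loss p y (2 * m)%N (2 * i).+1) / 2.
Proof.
move=> hp im; have m0 : 0 < m%:R :> R by rewrite ltr0n; lia.
rewrite /cutoff_loss.
have -> : (2 * i).+2%:R / (2 * m)%:R = i.+1%:R / m%:R :> R.
  by rewrite -!natr1 !natrM; field; rewrite lt0r_neq0.
have -> : (2 * i)%:R / (2 * m)%:R = i%:R / m%:R :> R.
  by rewrite !natrM; field; rewrite lt0r_neq0.
set w := (2 * i).+1%:R / _.
have wE : w = i%:R / m%:R + (2 * m%:R)^-1.
  by rewrite /w -natr1 !natrM; field; rewrite lt0r_neq0.
have wE' : i.+1%:R / m%:R = w + (2 * m%:R)^-1.
  by rewrite wE -natr1; field; rewrite lt0r_neq0.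
have hw : 0 < (2 * m%:R)^-1 :> R by rewrite invr_gt0 mulr_gt0.
set v := i.+1%:R / _ in wE' *; set u := i%:R / _ in wE *.
have A : \sum_(0 <= j < i.+1) posp (bias p y v m j) <=
   \sum_(0 <= j < (2 * i).+1) posp (bias p y v (2 * m)%N j)
   + posp (bias p y v (2 * m)%N (2 * i).+1) / 2.
  rewrite -(sum_refine (fun j => posp (bias p y v (2 * m)%N j))).
  by apply: ler_sum => j _; exact: posp_bias_refine.
have B : \sum_(i.+1 <= j < m.+1) posp (- bias p y u m j) <=
   \sum_((2 * i).+2 <= j < (2 * m).+1) posp (- bias p y u (2 * m)%N j)
   + posp (- bias p y u (2 * m)%N (2 * i).+1) / 2.
  pose Q j := posp (- bias p y u (2 * m)%N j).
  have := sum_refine Q m; rewrite (@big_cat_nat _ _ _ i.+1) //=; last by lia.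
  rewrite sum_refine (@big_cat_nat _ _ _ (2 * i).+1 0 (2 * m).+1) //=; last by lia.
  rewrite (@big_ltn _ _ _ (2 * i).+1 (2 * m).+1); last by lia.
  (* Cell [2m+1] is centred beyond 1 and has no weight, so nothing is left over at this end. *)
  have -> : Q (2 * m).+1 = 0.
    apply: posp_eq0; rewrite /bias (_ : Emp _ _ _ = 0) ?oppr0 //.
    by rewrite -(Emp0 p y); apply: eq_Emp => t; rewrite wgt_above ?mul0r.
  move=> E; rewrite -/(Q _).
  apply: (@le_trans _ _ (\sum_(i.+1 <= j < m.+1) (Q (2 * j)%N + Q (2 * j).+1%N / 2
    + (if j is j'.+1 then Q (2 * j').+1%N / 2 else 0)))).
    by apply: ler_sum => j _; exact: posp_biasN_refine.
  by rewrite -/(Q _); lra.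
(* Fine cutoff [2i] has thresholds [w] below and [u] above, fine cutoff [2i+1] has [v] below and [w]
   above. As [u < w < v], replacing [v] or [u] by [w] only raises the loss. *)
have A' : \sum_(0 <= j < (2 * i).+1) posp (bias p y v (2 * m)%N j) <=
   \sum_(0 <= j < (2 * i).+1) posp (bias p y w (2 * m)%N j).
  by apply: ler_sum => j _; apply/ler_posp/ler_bias; lra.
have B' : \sum_((2 * i).+2 <= j < (2 * m).+1) posp (- bias p y u (2 * m)%N j) <=
   \sum_((2 * i).+2 <= j < (2 * m).+1) posp (- bias p y w (2 * m)%N j).
  by apply: ler_sum => j _; apply: ler_posp; rewrite lerN2; apply: ler_bias; lra.
rewrite (@big_nat_recr _ _ _ (2 * i).+1 0) //=.
rewrite (@big_ltn _ _ _ (2 * i).+1 (2 * m).+1); last by lia.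
lra.
Qed.

Lemma SCDLm_double (R : realType) T (p : 'I_T -> R) y m :
  (forall t, 0 <= p t <= 1) -> (0 < m)%N -> SCDLm p y m <= SCDLm p y (2 * m)%N.
Proof.
move=> hp m0; rewrite [X in X <= _]SCDLmE; apply: bigmax_le => [|i _].
  by rewrite SCDLmE; apply: bigmax_ge_id.
have := ltn_ord i; rewrite ltnS leq_eqVlt => /predU1P[->|im].
  by rewrite cutoff_loss_last // SCDLmE; apply: bigmax_ge_id.
apply: le_trans (cutoff_loss_double _ hp im) _.
have /(cutoff_loss_le p y) : (2 * i <= 2 * m)%N by lia.
have /(cutoff_loss_le p y) : ((2 * i).+1 <= 2 * m)%N by lia.
by move=> ? ?; lra.
Qed.

Lemma SCDLm_le_SCDL (R : realType) T (p : 'I_T -> R) y k :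
  (forall t, 0 <= p t <= 1) -> (0 < k)%N -> SCDL p y < 2 / (2 ^ k)%:R ->
  SCDLm p y (2 ^ k)%N <= SCDL p y.
Proof.
move=> hp k0 hlt.
have mono a : SCDLm p y (2 ^ k)%N <= SCDLm p y (2 ^ (a + k))%N.
  elim: a => // a IH; apply: le_trans IH _.
  by rewrite addSn expnS SCDLm_double // expn_gt0.
(* Grids at least as fine as [2^k] are bounded below by monotonicity, coarser ones by their term
   [1/2^k' >= 2/2^k]; the assumption on [SCDL] then excludes the second alternative of the
   minimum. *)
have : Num.min (SCDLm p y (2 ^ k)%N) (2 / (2 ^ k)%:R) <= SCDL p y.
  apply: lb_le_inf => [|x [k' [k'0 ->]]].
    by exists (Num.max (SCDLm p y (2 ^ k)%N) ((2 ^ k)%:R)^-1); exists k.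
  rewrite le_max; have [kk'|kk'] := leqP k k'.
    by rewrite -(subnK kk') ge_min mono.
  apply/orP; right; rewrite ge_min; apply/orP; right.
  have h : 2 * (2 ^ k')%:R <= (2 ^ k)%:R :> R.
    by rewrite -natrM ler_nat -expnS leq_exp2l.
  by rewrite ler_pdivrMr ?ltr0n ?expn_gt0 // mulrC ler_pdivlMr // ltr0n expn_gt0.
by rewrite ge_min leNgt [_ / _ <= _]leNgt hlt orbF -leNgt.
Qed.

(** * Summing deviations over dyadic scales *)

(* For a cell at distance [d/m] from the cutoff, with [s ^+ 2] its mass and [mu], [X] its biases
   before and after rounding.  The two cases of the proof are [mu <= - s^2 d/(4m)], where the
   negative [mu] absorbs the linear term in [s], and its negation, where for [D >= 4] the shifted
   cutoff at distance [(D-1)/m] already charges the cell at least [s^2 D/(4m)]. *)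
Lemma dyadic_term (R : realType) (m D d s mu X eps : R) :
  0 < m -> 1 <= D -> D <= d <= 2 * D -> 0 <= s -> 0 <= eps ->
  X <= mu + 7 * eps * s + 7 * eps ^+ 2 ->
  posp X <= posp mu + 7 * eps ^+ 2 + 49 * eps ^+ 2 * (m / D)
    + 7 / 2 * eps * (D^-1 + (if D < 4 then D * s ^+ 2
                             else 4 * m * posp (mu + s ^+ 2 * ((D - 1) / m)))).
Proof.
move=> m0 D1 /andP[Dd dD] s0 e0 hX; have D0 : 0 < D by lra.
set G := if _ then _ else _.
have G0 : 0 <= G.
  by rewrite /G; case: ifP => _; rewrite !mulr_ge0 ?posp_ge0 ?exprn_ge0 //; lra.
have i0 : 0 < D^-1 by rewrite invr_gt0.
have a0 : 0 <= 7 * eps ^+ 2 by rewrite mulr_ge0 ?exprn_ge0.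
have b0 : 0 <= 49 * eps ^+ 2 * (m / D).
  by rewrite mulr_ge0 ?divr_ge0 ?mulr_ge0 ?exprn_ge0 // ltW.
have c0 : 0 <= 7 / 2 * eps * (D^-1 + G).
  by rewrite mulr_ge0 ?addr_ge0 ?mulr_ge0 //; lra.
have p0 := posp_ge0 mu; have p1 := posp_ge mu.
rewrite posp_le_iff; apply/andP; split; last by lra.
have [good|bad] := leP mu (- (s ^+ 2 * (d / (4 * m)))).
  have hd : s ^+ 2 * (D / (4 * m)) <= s ^+ 2 * (d / (4 * m)).
    by rewrite ler_wpM2l ?exprn_ge0 // ler_pM2r // invr_gt0; lra.
  have amgm : 7 * eps * s <= s ^+ 2 * (D / (4 * m)) + 49 * eps ^+ 2 * (m / D).
    rewrite -subr_ge0 (_ : _ - _ = (s * D / (2 * m) - 7 * eps) ^+ 2 * (m / D)).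
      by rewrite mulr_ge0 ?sqr_ge0 // divr_ge0 // ltW.
    by field; rewrite !lt0r_neq0.
  by lra.
have hG : D * s ^+ 2 <= G.
  rewrite /G; case: ltP => // D4.
  have : mu + s ^+ 2 * ((D - 1) / m) <= posp (mu + s ^+ 2 * ((D - 1) / m)).
    exact: posp_ge.
  set P := posp _ => hP.
  have : 4 * m * (- (s ^+ 2 * (d / (4 * m))) + s ^+ 2 * ((D - 1) / m)) <= 4 * m * P.
    by rewrite ler_pM2l; lra.
  have -> : 4 * m * (- (s ^+ 2 * (d / (4 * m))) + s ^+ 2 * ((D - 1) / m))
     = s ^+ 2 * (4 * (D - 1) - d) by field; rewrite lt0r_neq0.
  (* [4 * (D - 1) - d >= D] because [d <= 2 * D] and [D >= 4]; this fixes the threshold 4. *)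
  apply: le_trans; rewrite mulrC ler_wpM2l ?exprn_ge0 //; lra.
have amgm : 2 * s <= D^-1 + D * s ^+ 2.
  rewrite -subr_ge0 (_ : _ - _ = (D * s - 1) ^+ 2 * D^-1).
    by rewrite mulr_ge0 ?sqr_ge0 // ltW.
  by field; rewrite lt0r_neq0.
have : 7 / 2 * eps * (2 * s) <= 7 / 2 * eps * (D^-1 + G).
  by rewrite ler_wpM2l; lra.
lra.
Qed.

(** The scale has [D = 2^a] cells, so the terms [eps^2 m/D] add up to [eps * (eps m) <= eps] and the
    terms [eps/D] to [eps]; the miscalibrated cells are charged to the total mass or to the loss at
    the shifted cutoff. *)
Lemma dyadic_scale (R : realType) (k a : nat) (eps : R) (pr mu X : nat -> R) :
  (a <= k)%N -> 0 <= eps -> eps * (2 ^ k)%:R <= 1 ->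
  (forall d, 0 <= pr d) ->
  (forall d, X d <= mu d + 7 * eps * Num.sqrt (pr d) + 7 * eps ^+ 2) ->
  \sum_(2 ^ a <= d < 2 ^ a.+1) pr d <= 1 ->
  \sum_(2 ^ a <= d < 2 ^ a.+1)
    posp (mu d + pr d * (((2 ^ a)%:R - 1) / (2 ^ k)%:R)) <= 2 / (2 ^ k)%:R ->
  \sum_(2 ^ a <= d < 2 ^ a.+1) posp (X d) <=
  \sum_(2 ^ a <= d < 2 ^ a.+1) posp (mu d) + 88 * eps.
Proof.
move=> ak e0 em pr0 hX hpr hbad.
have m0 : 0 < (2 ^ k)%:R :> R by rewrite ltr0n expn_gt0.
have D1 : 1 <= (2 ^ a)%:R :> R by rewrite ler1n expn_gt0.
have Dm : (2 ^ a)%:R <= (2 ^ k)%:R :> R by rewrite ler_nat leq_exp2l.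
set D : R := (2 ^ a)%:R in D1 Dm hbad *; set m : R := (2 ^ k)%:R in m0 em Dm hbad *.
have D0 : 0 < D by lra.
have term d : (2 ^ a <= d < 2 ^ a.+1)%N ->
  posp (X d) <= posp (mu d) + ((7 * eps ^+ 2 + 49 * eps ^+ 2 * (m / D) + 7 / 2 * eps * D^-1)
    + 7 / 2 * eps * (if D < 4 then D * pr d else 4 * m * posp (mu d + pr d * ((D - 1) / m)))).
  move=> /andP[d1 d2].
  have := @dyadic_term R m D d%:R (Num.sqrt (pr d)) (mu d) (X d) eps m0 D1.
  rewrite sqr_sqrtr // => /(_ _ (sqrtr_ge0 _) e0 (hX d)) H.
  apply: (le_trans (H _)); last by lra.
  by rewrite ler_nat d1 /D -natrM ler_nat -expnS ltnW.
apply: le_trans (ler_sum_nat term) _; rewrite big_split /= lerD2l big_split /= sumr_const_nat.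
have -> : (2 ^ a.+1 - 2 ^ a = 2 ^ a)%N by rewrite expnS mul2n -addnn addnK.
rewrite -mulr_sumr -[_ *+ (2 ^ a)%N]mulr_natr -/D.
set S := \sum_(_ <= d < _) _.
(* For [D < 4] the mass bound gives [D]; otherwise the shifted cutoff gives [4m * 2/m]. *)
have hS : S <= 8.
  rewrite /S; have [D4|D4] := ltP D 4.
    rewrite -mulr_sumr; apply: (@le_trans _ _ (D * 1)); last by lra.
    by rewrite ler_wpM2l //; lra.
  rewrite -mulr_sumr; apply: (@le_trans _ _ (4 * m * (2 / m))).
    by rewrite ler_wpM2l //; lra.
  by rewrite (_ : _ * _ = 8) //; field; rewrite lt0r_neq0.
have -> : (7 * eps ^+ 2 + 49 * eps ^+ 2 * (m / D) + 7 / 2 * eps * D^-1) * D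
  = 7 * eps * (eps * D) + 49 * eps * (eps * m) + 7 / 2 * eps.
  by field; rewrite lt0r_neq0.
have h1 : 7 / 2 * eps * S <= 7 / 2 * eps * 8 by rewrite ler_wpM2l //; lra.
have h2 : 49 * eps * (eps * m) <= 49 * eps * 1 by rewrite ler_wpM2l //; lra.
have h3 : 7 * eps * (eps * D) <= 7 * eps * 1.
  by rewrite ler_wpM2l //; [lra | apply: le_trans em; rewrite ler_wpM2l].
(* The four contributions are 7 + 49 + 7/2 + 28 = 87.5 times [eps]. *)
lra.
Qed.

Lemma dyadic_deviation (R : realType) (k : nat) (eps : R) (pr mu X : nat -> R) :
  0 <= eps -> eps * (2 ^ k)%:R <= 1 ->
  (forall d, 0 <= pr d) ->
  (forall d, X d <= mu d + 7 * eps * Num.sqrt (pr d) + 7 * eps ^+ 2) ->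
  (forall a, (a <= k)%N -> \sum_(2 ^ a <= d < 2 ^ a.+1) pr d <= 1) ->
  (forall a, (a <= k)%N -> \sum_(2 ^ a <= d < 2 ^ a.+1)
    posp (mu d + pr d * (((2 ^ a)%:R - 1) / (2 ^ k)%:R)) <= 2 / (2 ^ k)%:R) ->
  \sum_(1 <= d < 2 ^ k.+1) posp (X d) <=
  \sum_(1 <= d < 2 ^ k.+1) posp (mu d) + 88 * eps * k.+1%:R.
Proof.
move=> e0 em pr0 hX hpr hbad.
have H n : (n <= k.+1)%N -> \sum_(1 <= d < 2 ^ n) posp (X d) <=
  \sum_(1 <= d < 2 ^ n) posp (mu d) + 88 * eps * n%:R; last exact: H.
elim: n => [_|n IH nk]; first by rewrite expn0 !big_geq // mulr0 addr0.
have h : (1 <= 2 ^ n <= 2 ^ n.+1)%N by rewrite expn_gt0 leq_exp2l /=.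
case/andP: h => h1 h2.
rewrite !(@big_cat_nat _ _ _ (2 ^ n) 1 (2 ^ n.+1)) //=.
have := IH (ltnW nk); have := @dyadic_scale R k n eps pr mu X nk e0 em pr0 hX (hpr _ nk) (hbad _ nk).
rewrite -natr1; lra.
Qed.

(** * Swap regret on a grid *)

Lemma exp_utilB (R : realType) A (U : A -> bool -> R) a b p q :
  exp_util U a q - exp_util U b q = exp_util U a p - exp_util U b p
    + ((U a true - U a false) - (U b true - U b false)) * (q - p).
Proof. by rewrite /exp_util; ring. Qed.

(* The slope of the convex function [q |-> max_a exp_util U a q] at the grid point [i/m]. *)
Definition slope (R : realType) A (U : A -> bool -> R) (r : R -> A) (m i : nat) : R :=
  U (r (i%:R / m%:R)) true - U (r (i%:R / m%:R)) false.

Lemma grid_itv (R : realType) (m i : nat) : (0 < m)%N -> (i <= m)%N ->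
  0 <= (i%:R / m%:R : R) <= 1.
Proof.
by move=> m0 im; rewrite divr_ge0 //= ler_pdivrMr ?ltr0n // mul1r ler_nat.
Qed.

Lemma gridS (R : realType) (m i : nat) : i.+1%:R / m%:R = i%:R / m%:R + m%:R^-1 :> R.
Proof. by rewrite -natr1 mulrDl mul1r. Qed.

(** Add the optimality conditions at two neighbouring grid points; this is the convexity of the
    optimal utility. *)
Lemma slope_le (R : realType) A (U : A -> bool -> R) r m i :
  best_response U r -> (i < m)%N -> slope U r m i <= slope U r m i.+1.
Proof.
move=> hr im; have m0 : (0 < m)%N by lia.
have h1 := hr _ (grid_itv R m0 (ltnW im)) (r (i.+1%:R / m%:R)).
have h2 := hr _ (grid_itv R m0 im) (r (i%:R / m%:R)).
have := exp_utilB U (r (i.+1%:R / m%:R)) (r (i%:R / m%:R)) (i%:R / m%:R) (i.+1%:R / m%:R).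
move=> E.
have : 0 <= (slope U r m i.+1 - slope U r m i) * (i.+1%:R / m%:R - i%:R / m%:R).
  by rewrite /slope; lra.
have mi : 0 < m%:R^-1 :> R by rewrite invr_gt0 ltr0n.
by rewrite (_ : i.+1%:R / _ - _ = m%:R^-1) ?pmulr_lge0 ?subr_ge0 // gridS; ring.
Qed.

Lemma grid_cell (R : realType) (m : nat) (q : R) : (0 < m)%N -> 0 <= q <= 1 ->
  exists2 l, (l < m)%N & l%:R / m%:R <= q <= l.+1%:R / m%:R.
Proof.
move=> m0 /andP[q0 q1]; have mR : 0 < m%:R :> R by rewrite ltr0n.
(* The endpoint 1 belongs to the last cell, whereas truncation would return [m]. *)
have [q1'|q1'] := ltP q 1; last first.
  exists m.-1; first by lia.
  rewrite prednK // divff ?lt0r_neq0 // q1 (le_trans _ q1') //.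
  by have /andP[] := grid_itv R m0 (leq_pred m).
have /andP[l1 l2] : (Num.truncn (q * m%:R))%:R <= q * m%:R < (Num.truncn (q * m%:R)).+1%:R.
  by apply: truncn_itv; rewrite mulr_ge0.
exists (Num.truncn (q * m%:R)).
  by rewrite -(ltr_nat R) (le_lt_trans l1) // -[X in _ < X]mul1r ltr_pM2r.
by rewrite ler_pdivrMr // l1 ler_pdivlMr // ltW.
Qed.

Lemma subsum_le (R : realType) (F : nat -> R) a b m :
  (forall i, (i < m)%N -> 0 <= F i) -> (a <= b <= m)%N ->
  \sum_(a <= i < b) F i <= \sum_(0 <= i < m) F i.
Proof.
move=> F0 /andP[ab bm]; rewrite (@big_cat_nat _ _ _ a 0 m) //=; last exact: leq_trans bm.
rewrite (@big_cat_nat _ _ _ b a m) //= addrCA lerDl addr_ge0 //.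
  by rewrite big_nat sumr_ge0 // => i /andP[_ h]; apply: F0; lia.
by rewrite big_nat sumr_ge0 // => i /andP[_ h]; apply: F0.
Qed.

Lemma affine_below_chord (R : realType) (f0 s D t w : R) :
  f0 <= 0 -> f0 + s * w <= D * w -> 0 <= t <= w -> f0 + s * t <= D * t.
Proof.
move=> h0 hw /andP[t0 tw]; have [sD|sD] := leP s D.
  by have := ler_wpM2r t0 sD; lra.
have : (s - D) * t <= (s - D) * w by rewrite ler_wpM2l //; lra.
lra.
Qed.

(* A discrete form of the decomposition of a Bregman divergence into V-shaped losses:
   consecutive best responses differ by an affine function with slope
   [slope (i+1) - slope i] whose root lies in the cell [[i/m, (i+1)/m]]. *)
Lemma regret_le_cutoffs (R : realType) A (U : A -> bool -> R) r m j a q :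
  best_response U r -> (j <= m)%N -> (0 < m)%N -> 0 <= q <= 1 ->
  exp_util U a q - exp_util U (r (j%:R / m%:R)) q <=
  \sum_(0 <= i < m) (slope U r m i.+1 - slope U r m i) *
    (if (j <= i)%N then posp (q - i%:R / m%:R) else posp (i.+1%:R / m%:R - q)).
Proof.
move=> hr jm m0 hq.
pose h i := exp_util U (r (i%:R / m%:R)) q.
pose D i := slope U r m i.+1 - slope U r m i.
have D0 i : (i < m)%N -> 0 <= D i by move=> im; rewrite subr_ge0 slope_le.
set F := BIG_F.
have F0 i : (i < m)%N -> 0 <= F i.
  by move=> im; rewrite mulr_ge0 ?D0 //; case: ifP => _; exact: posp_ge0.
(* As functions of [q] the two utilities differ by an affine function of slope [D i], which is at
   most 0 at [i/m] by optimality there. *)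
have up i : (i < m)%N -> h i.+1 - h i <= D i * posp (q - i%:R / m%:R).
  move=> im; have := hr _ (grid_itv R m0 (ltnW im)) (r (i.+1%:R / m%:R)).
  rewrite /h (exp_utilB _ _ _ (i%:R / m%:R)) => e.
  apply: (@le_trans _ _ (D i * (q - i%:R / m%:R))); first by rewrite /D /slope; lra.
  by rewrite ler_wpM2l ?D0 ?posp_ge.
have down i : (i < m)%N -> h i - h i.+1 <= D i * posp (i.+1%:R / m%:R - q).
  move=> im; have := hr _ (grid_itv R m0 im) (r (i%:R / m%:R)).
  rewrite /h (exp_utilB _ _ _ (i.+1%:R / m%:R)) => e.
  apply: (@le_trans _ _ (D i * (i.+1%:R / m%:R - q))); first by rewrite /D /slope; lra.
  by rewrite ler_wpM2l ?D0 ?posp_ge.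
have [l lm /andP[ql qr]] := grid_cell m0 hq.
have mi : 0 < m%:R^-1 :> R by rewrite invr_gt0 ltr0n.
(* The advantage of [a] over the best response at one end of the cell is affine, at most 0 at that
   end, and at most [D l / m] at the other end, where the best response of that other end dominates
   [a]. *)
have cell : exp_util U a q <= h l + D l * (q - l%:R / m%:R) /\
            exp_util U a q <= h l.+1 + D l * (l.+1%:R / m%:R - q).
  have hl := hr _ (grid_itv R m0 (ltnW lm)); have hl1 := hr _ (grid_itv R m0 lm).
  set x0 : R := l%:R / m%:R in ql hl *; set x1 : R := l.+1%:R / m%:R in qr hl1 *.
  have E1 := exp_utilB U a (r x0) x0; have E2 := exp_utilB U a (r x1) x1.
  have E3 := exp_utilB U (r x1) (r x0) x0 x1.
  have := hl (r x1); have := hl1 (r x0); have := hl a; have := hl1 a => a1 a0 r0 r1.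
  split.
    suff : exp_util U a x0 - exp_util U (r x0) x0
       + ((U a true - U a false) - slope U r m l) * (q - x0) <= D l * (q - x0).
      by have := E1 q; rewrite /h -/(slope U r m l); lra.
    apply: (@affine_below_chord _ _ _ _ _ (x1 - x0)); [lra | | lra].
    by have := E1 x1; move: E3; rewrite /D /slope -/x0 -/x1; lra.
  suff : exp_util U a x1 - exp_util U (r x1) x1
     + (slope U r m l.+1 - (U a true - U a false)) * (x1 - q) <= D l * (x1 - q).
    by have := E2 q; rewrite /h /slope -/x1; lra.
  apply: (@affine_below_chord _ _ _ _ _ (x1 - x0)); [lra | | lra].
  have := E2 x0; move: E3; rewrite /D /slope -/x0 -/x1; lra.
(* Walk from [j] to the cell of [q], upwards or downwards: the steps telescope, and cell [l] itself
   supplies the remaining term. *)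
case: cell => cl cr; have [jl|lj] := leqP j l.
  apply: (@le_trans _ _ (\sum_(j <= i < l.+1) F i)); last by apply: (subsum_le F0); lia.
  rewrite big_nat_recr //= /F jl (posp_id (x := q - _)); last by lra.
  suff : h l - h j <= \sum_(j <= i < l) F i by move: cl; rewrite -/(h j) -/(D l) /F; lra.
  rewrite -telescope_sumr //; apply: ler_sum_nat => i /andP[ji il].
  by rewrite /F ji up //; lia.
apply: (@le_trans _ _ (\sum_(l <= i < j) F i)); last by apply: (subsum_le F0); lia.
rewrite big_ltn // /F leqNgt lj /= (posp_id (x := _ - q)); last by lra.
suff : h l.+1 - h j <= \sum_(l.+1 <= i < j) F i.
  by move: cr; rewrite -/(h j) -/(D l) /F; lra.
rewrite -[X in X <= _]opprB -telescope_sumr // -sumrN; apply: ler_sum_nat => i /andP[li ij].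
by rewrite opprB /F leqNgt ij down //; lia.
Qed.

Lemma wgt_grid (R : realType) (m i j : nat) : (0 < m)%N ->
  wgt m j (i%:R / m%:R : R) = (i == j)%:R.
Proof.
move=> m0; rewrite /wgt mulrCA divff ?mulr1; last by rewrite pnatr_eq0 -lt0n.
case: (ltngtP i j) => [ij|ij|->]; last by rewrite subrr normr0 subr0 posp_id.
  apply: posp_eq0; have : i%:R + 1 <= j%:R :> R by rewrite natr1 ler_nat.
  by move=> ?; rewrite ler0_norm; lra.
apply: posp_eq0; have : j%:R + 1 <= i%:R :> R by rewrite natr1 ler_nat.
by move=> ?; rewrite ger0_norm; lra.
Qed.

Lemma rounded_itv (R : realType) T m (o : {ffun 'I_T -> 'I_m.+1}) t : (0 < m)%N ->
  0 <= (rounded o t : R) <= 1.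
Proof. by move=> m0; apply: grid_itv => //; rewrite -ltnS. Qed.

(** On grid points the weights are indicators of the cells. *)
Lemma Emp_rounded (R : realType) T m (o : {ffun 'I_T -> 'I_m.+1}) y (f : R -> bool -> R) :
  (0 < m)%N ->
  Emp (rounded o) y f = \sum_(0 <= j < m.+1)
     Emp (rounded o) y (fun q b => wgt m j q * f (j%:R / m%:R) b).
Proof.
move=> m0; rewrite /Emp -mulr_sumr exchange_big /=; congr (_ * _).
apply: eq_bigr => t _; rewrite big_mkord (bigD1 (o t)) //= big1 => [|j jo].
  by rewrite /rounded wgt_grid // eqxx mul1r addr0.
rewrite /rounded wgt_grid // (_ : (o t == j :> nat) = false) ?mul0r //.
by apply/negbTE; rewrite eq_sym.
Qed.

Lemma sum_pi (R : realType) T (p : 'I_T -> R) y m : (0 < T)%N ->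
  (forall t, 0 <= p t <= 1) -> \sum_(0 <= j < m.+1) pi_ p y m j = 1.
Proof.
move=> T0 hp; rewrite /pi_ /Emp -mulr_sumr exchange_big /=.
under eq_bigr => t _ do rewrite big_mkord sum_wgt //.
by rewrite sumr_const card_ord mulVf // pnatr_eq0 -lt0n.
Qed.

Lemma q_itv (R : realType) T (p : 'I_T -> R) y m j : 0 <= q_ p y m j <= 1.
Proof.
rewrite /q_; case: eqP => [_|/eqP h]; first by rewrite lexx ler01.
have h0 : 0 < pi_ p y m j by rewrite lt_neqAle eq_sym h pi_ge0.
rewrite divr_ge0 ?pi_ge0 //=; last first.
  by rewrite -(Emp0 p y); apply: ler_Emp => t; rewrite mulr_ge0 ?wgt_ge0.
rewrite ler_pdivrMr // mul1r; apply: ler_Emp => t.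
by case: (y t); rewrite ?mulr1 ?mulr0 ?wgt_ge0.
Qed.

Lemma bias_shift (R : realType) T (p : 'I_T -> R) y m j v v' :
  bias p y v m j = bias p y v' m j + pi_ p y m j * (v' - v).
Proof. by rewrite -!pi_qE; ring. Qed.

Lemma Emp_utilB (R : realType) T (p : 'I_T -> R) y m j A (U : A -> bool -> R) a c :
  Emp p y (fun q b => wgt m j q * (U a b - U c b)) =
  pi_ p y m j * (exp_util U a (q_ p y m j) - exp_util U c (q_ p y m j)).
Proof.
rewrite (exp_utilB _ _ _ 0) mulrDr mulrCA subr0 -[q_ _ _ _ _]subr0 pi_qE.
rewrite [pi_ _ _ _ _ * _]mulrC -!EmpZ -EmpD; apply: eq_Emp => t.
by rewrite /exp_util; case: (y t) => /=; ring.
Qed.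

Lemma cutoff_lossE (R : realType) T (p : 'I_T -> R) y m i : (i <= m)%N ->
  cutoff_loss p y m i = \sum_(0 <= j < m.+1)
    (if (j <= i)%N then posp (bias p y (i.+1%:R / m%:R) m j)
     else posp (- bias p y (i%:R / m%:R) m j)).
Proof.
move=> im; rewrite (@big_cat_nat _ _ _ i.+1 0 m.+1) //; congr (_ + _).
  by apply: eq_big_nat => j /andP[_ ji]; rewrite -ltnS ji.
by apply: eq_big_nat => j /andP[ij _]; rewrite leqNgt ij.
Qed.

Lemma SR_le_SCDLm (R : realType) A (U : A -> bool -> R) r T m
    (o : {ffun 'I_T -> 'I_m.+1}) y :
  utility_ok U -> best_response U r -> (0 < m)%N -> (0 < T)%N ->
  SR U r (rounded o) y <= 2 * SCDLm (rounded o : 'I_T -> R) y m + 2 / m%:R.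
Proof.
move=> hU hr m0 T0; set p : 'I_T -> R := rounded o.
have hp t : 0 <= p t <= 1 by exact: rounded_itv.
have mR : 0 < m%:R :> R by rewrite ltr0n.
have mi : 0 < m%:R^-1 :> R by rewrite invr_gt0.
pose D i := slope U r m i.+1 - slope U r m i.
have D0 i : (i < m)%N -> 0 <= D i by move=> im; rewrite subr_ge0 slope_le.
apply: ge_sup => [|_ [sigma ->]].
  by exists (Emp p y (fun q b => U (id (r q)) b - U (r q) b)); exists id.
rewrite Emp_rounded // -/p.
(* [regret_le_cutoffs] has its kinks at [i/m] for [j <= i] and at [(i+1)/m] for [j > i], at the
   opposite end of the cell from those of [SCDLm]; moving a kink across the cell costs [pi_j/m]. *)
apply: (@le_trans _ _ (\sum_(0 <= j < m.+1) \sum_(0 <= i < m) D i *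
   ((if (j <= i)%N then posp (bias p y (i.+1%:R / m%:R) m j)
     else posp (- bias p y (i%:R / m%:R) m j)) + pi_ p y m j / m%:R))).
  apply: ler_sum_nat => j /andP[_ jm]; rewrite Emp_utilB.
  have pj := pi_ge0 p y m j.
  have jm' : (j <= m)%N by rewrite -ltnS.
  have := regret_le_cutoffs (sigma (r (j%:R / m%:R))) hr jm' m0 (q_itv p y m j).
  move=> /(ler_wpM2l pj) /le_trans; apply.
  rewrite mulr_sumr; apply: ler_sum_nat => i /andP[_ im].
  rewrite mulrCA ler_wpM2l ?D0 //.
  have e0 : posp (pi_ p y m j / m%:R) = pi_ p y m j / m%:R.
    by rewrite posp_id // divr_ge0 // ltW.
  case: ifP => _; rewrite pospM //.
    rewrite pi_qE (bias_shift _ _ _ _ _ (i.+1%:R / m%:R)) gridS.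
    by rewrite addrAC subrr add0r -[X in _ <= _ + X]e0 ler_pospD.
  rewrite -[_ / _ - _]opprB mulrN pi_qE (bias_shift _ _ _ _ _ (i%:R / m%:R)) gridS.
  rewrite -[X in _ <= _ + X]e0; apply: le_trans (ler_pospD _ _).
  by apply: ler_posp; lra.
rewrite exchange_big /=.
apply: (@le_trans _ _ (\sum_(0 <= i < m) D i * (SCDLm p y m + m%:R^-1))).
  apply: ler_sum_nat => i /andP[_ im]; rewrite -mulr_sumr ler_wpM2l ?D0 //.
  rewrite big_split /= -mulr_suml sum_pi // mul1r lerD2r.
  by rewrite -cutoff_lossE ?cutoff_loss_le // ltnW.
rewrite -mulr_suml telescope_sumr //.
have S0 : 0 <= SCDLm p y m by rewrite SCDLmE; apply: bigmax_ge_id.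
(* Slopes lie in [[-1, 1]], so their total increase, the mass of the mixture, is at most 2. *)
apply: (@le_trans _ _ (2 * (SCDLm p y m + m%:R^-1))); last by lra.
rewrite ler_wpM2r //; first by lra.
rewrite /slope; have := hU (r (m%:R / m%:R)); have := hU (r (0%:R / m%:R)).
move=> h h'; have := h true; have := h false; have := h' true; have := h' false.
do 4 (move=> /andP[? ?]); lra.
Qed.

(** * Concentration of the rounded sample *)

(** Invert [1 - x <= expR (- x)]. Negative [x] is included, which the lower tails require. *)
Lemma expR_le_quadratic (R : realType) (x : R) : x <= 1 / 2 ->
  expR x <= 1 + x + 2 * x ^+ 2.
Proof.
move=> hx; have x1 : 0 < 1 - x by lra.
have h : 1 - x <= expR (- x) by exact: expR_ge1Dx.
have -> : expR x = (expR (- x))^-1 by rewrite expRN invrK.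
apply: (@le_trans _ _ (1 - x)^-1).
  by rewrite lef_pV2 ?posrE ?expR_gt0.
rewrite -[X in X <= _]mul1r ler_pdivrMr // -subr_ge0.
rewrite (_ : _ - _ = x ^+ 2 * (1 - 2 * x)); last by ring.
by rewrite mulr_ge0 ?sqr_ge0 //; lra.
Qed.

Lemma round_prob_ge0 (R : realType) T m (p : 'I_T -> R) (o : {ffun 'I_T -> 'I_m.+1}) :
  0 <= round_prob p o.
Proof. by apply: prodr_ge0 => t _; exact: wgt_ge0. Qed.

(** Independence of the roundings, in the form needed for moment generating functions. *)
Lemma round_prob_sum (R : realType) T m (p : 'I_T -> R) (F : 'I_T -> 'I_m.+1 -> R) :
  \sum_(o : {ffun 'I_T -> 'I_m.+1}) round_prob p o * \prod_t F t (o t)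
  = \prod_t \sum_(i < m.+1) wgt m i (p t) * F t i.
Proof. by rewrite bigA_distr_bigA; apply: eq_bigr => o _; rewrite -big_split. Qed.

Lemma Prob_setT (R : realType) T m (p : 'I_T -> R) : (forall t, 0 <= p t <= 1) ->
  \sum_(o : {ffun 'I_T -> 'I_m.+1}) round_prob p o = 1.
Proof.
move=> hp; transitivity (\sum_(o : {ffun 'I_T -> 'I_m.+1}) round_prob p o * \prod_(t < T) 1).
  by apply: eq_bigr => o _; rewrite big1 ?mulr1.
rewrite (round_prob_sum p (fun _ _ => 1)) big1 // => t _.
by under eq_bigr => i _ do rewrite mulr1; rewrite sum_wgt.
Qed.

Lemma le_Prob (R : realType) T m (p : 'I_T -> R) (E F : {ffun 'I_T -> 'I_m.+1} -> Prop) :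
  (forall o, E o -> F o) -> Prob p E <= Prob p F.
Proof.
move=> EF; rewrite /Prob [X in X <= _]big_mkcond [X in _ <= X]big_mkcond /=.
apply: ler_sum => o _; case: asboolP => [/EF Fo|_]; first by rewrite asboolT.
by case: ifP => // _; exact: round_prob_ge0.
Qed.

Lemma ProbC (R : realType) T m (p : 'I_T -> R) (E : {ffun 'I_T -> 'I_m.+1} -> Prop) :
  (forall t, 0 <= p t <= 1) -> Prob p E = 1 - Prob p (fun o => ~ E o).
Proof.
move=> hp; rewrite -(Prob_setT m hp) (bigID (fun o => `[< E o >])) /= /Prob.
rewrite [X in _ = _ + X - _](eq_bigl (fun o => `[< ~ E o >])) ?addrK // => o.
by rewrite asbool_neg.
Qed.

Lemma Prob_union (R : realType) T m (p : 'I_T -> R) (I : finType)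
    (E : I -> {ffun 'I_T -> 'I_m.+1} -> Prop) :
  Prob p (fun o => exists i, E i o) <= \sum_i Prob p (E i).
Proof.
rewrite /Prob; under [X in _ <= X]eq_bigr => i _ do rewrite big_mkcond.
rewrite exchange_big big_mkcond /=; apply: ler_sum => o _.
have h0 i : 0 <= (if `[< E i o >] then round_prob p o else 0).
  by case: ifP => // _; exact: round_prob_ge0.
case: asboolP => [[i Ei]|_]; last exact: sumr_ge0.
by rewrite (bigD1 i) //= asboolT // lerDl sumr_ge0.
Qed.

Lemma Prob_exp_markov (R : realType) T m (p : 'I_T -> R)
    (X : {ffun 'I_T -> 'I_m.+1} -> R) (a : R) :
  Prob p (fun o => a <= X o) <= expR (- a) * \sum_o round_prob p o * expR (X o).
Proof.
rewrite /Prob big_mkcond mulr_sumr; apply: ler_sum => o _.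
have h : 0 <= expR (- a) * (round_prob p o * expR (X o)).
  by rewrite !mulr_ge0 ?round_prob_ge0 ?expR_ge0.
case: asboolP => // aX; rewrite mulrCA -expRD ler_peMr ?round_prob_ge0 //.
by rewrite -[X in X <= _]expR0 ler_expR; lra.
Qed.

(** Counting each label separately makes the bias at any threshold [v] a linear combination of two
    counts, so that one event serves all [v] at once. *)
Definition hits (R : realType) T m (o : {ffun 'I_T -> 'I_m.+1}) (y : 'I_T -> bool)
  (j : nat) (b : bool) : R := \sum_t ((o t == j :> nat) && (y t == b))%:R.

Definition mean_hits (R : realType) T (p : 'I_T -> R) (y : 'I_T -> bool) m j b : R :=
  \sum_t wgt m j (p t) * (y t == b)%:R.

(** With [w] the weight of cell [j] at [p_t], a rounding with label [b] contributes the factor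
    [1 + w (e^l - 1)], at most [exp (w (l + 2 l^2))]; one with the other label contributes 1. *)
Lemma hits_mgf (R : realType) T m (p : 'I_T -> R) y j b (l : R) :
  (forall t, 0 <= p t <= 1) -> (j <= m)%N -> l <= 1 / 2 ->
  \sum_(o : {ffun 'I_T -> 'I_m.+1}) round_prob p o * expR (l * hits R o y j b)
  <= expR ((l + 2 * l ^+ 2) * mean_hits p y m j b).
Proof.
move=> hp jm hl.
under eq_bigr => o _ do rewrite /hits mulr_sumr expR_sum.
rewrite (round_prob_sum p (fun t (i : 'I_m.+1) => expR (l * ((i == j :> nat) && (y t == b))%:R))).
rewrite /mean_hits mulr_sumr expR_sum; apply: ler_prod => t _.
apply/andP; split; first by apply: sumr_ge0 => i _; rewrite mulr_ge0 ?wgt_ge0 ?expR_ge0.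
pose j' : 'I_m.+1 := Ordinal (jm : (j < m.+1)%N).
have -> : \sum_(i < m.+1) wgt m i (p t) * expR (l * ((i == j :> nat) && (y t == b))%:R)
   = 1 + wgt m j (p t) * (expR (l * (y t == b)%:R) - 1).
  have S := sum_wgt m (hp t); rewrite (bigD1 j') //= in S.
  rewrite (bigD1 j') //= eqxx /= (eq_bigr (fun i : 'I_m.+1 => wgt m i (p t))).
    by rewrite mulrBr mulr1; lra.
  by move=> i /negbTE; rewrite -val_eqE /= => ->; rewrite mulr0 expR0 mulr1.
apply: le_trans (expR_ge1Dx _); rewrite lerD2l mulrCA ler_wpM2l ?wgt_ge0 //.
case: (y t == b); rewrite ?mulr1 ?mulr0 ?expR0 ?subrr //.
by have := expR_le_quadratic hl; lra.
Qed.

(** The sign of [l] selects the tail: negative [l] gives the lower one. *)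
Lemma hits_tail (R : realType) T m (p : 'I_T -> R) y j b (x l : R) :
  (forall t, 0 <= p t <= 1) -> (j <= m)%N -> l <= 1 / 2 ->
  Prob p (fun o : {ffun 'I_T -> 'I_m.+1} => x <= l * (hits R o y j b - mean_hits p y m j b))
  <= expR (2 * l ^+ 2 * mean_hits p y m j b - x).
Proof.
move=> hp jm hl; set M := mean_hits _ _ _ _ _.
apply: (@le_trans _ _ (Prob p (fun o : {ffun 'I_T -> 'I_m.+1} => x + l * M <= l * hits R o y j b))).
  by apply: le_Prob => o; lra.
apply: le_trans (Prob_exp_markov _ _ _) _.
apply: le_trans (ler_wpM2l (expR_ge0 _) (hits_mgf y b hp jm hl)) _.
by rewrite -expRD ler_expR -/M; lra.
Qed.

(** Optimises the exponent. Small means take the extreme rate 1/2, large ones the Gaussian rate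
    [sqrt (L/P) / 2]; either way the left side is at most [7/2 L], whence the 7. The [3 L] buys
    failure probability [delta^3] for the union bound. *)
Lemma chernoff_rate (R : realType) (P L : R) : 0 < L -> 0 <= P ->
  exists2 l, 0 < l <= 1 / 2 & 2 * l ^+ 2 * P + 3 * L <= l * (7 * (Num.sqrt (P * L) + L)).
Proof.
move=> L0 P0; have [PL|LP] := leP P L.
  exists (1 / 2); first by apply/andP; split; lra.
  by have := sqrtr_ge0 (P * L); lra.
have P1 : 0 < P by lra.
have u0 : 0 < Num.sqrt P by rewrite sqrtr_gt0.
have s0 : 0 < Num.sqrt L by rewrite sqrtr_gt0.
have E1 : Num.sqrt P ^+ 2 = P by rewrite sqr_sqrtr.
have E2 : Num.sqrt L ^+ 2 = L by rewrite sqr_sqrtr // ltW.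
have su : Num.sqrt L <= Num.sqrt P by rewrite ler_sqrt // ltW.
rewrite sqrtrM //; set u := Num.sqrt P in u0 E1 su *; set s := Num.sqrt L in s0 E2 su *.
exists (s / (2 * u)).
  by rewrite divr_gt0 ?mulr_gt0 //= ler_pdivrMr ?mulr_gt0 //; lra.
rewrite -E1 -E2 -subr_ge0 (_ : _ - _ = 7 / 2 * s ^+ 3 / u).
  by rewrite divr_ge0 ?mulr_ge0 ?exprn_ge0 // ?ltW //; lra.
by field; rewrite lt0r_neq0.
Qed.

Lemma mean_hits_le (R : realType) T (p : 'I_T -> R) y m j b : (0 < T)%N ->
  mean_hits p y m j b <= T%:R * pi_ p y m j.
Proof.
move=> T0; rewrite /pi_ /Emp mulrA divff ?mul1r ?pnatr_eq0 -?lt0n //.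
by apply: ler_sum => t _; case: (_ == _); rewrite ?mulr1 ?mulr0 ?wgt_ge0.
Qed.

Lemma hits_deviation (R : realType) T m (p : 'I_T -> R) y j b (L : R) (c : bool) :
  (forall t, 0 <= p t <= 1) -> (j <= m)%N -> (0 < T)%N -> 0 < L ->
  Prob p (fun o : {ffun 'I_T -> 'I_m.+1} =>
    7 * (Num.sqrt (T%:R * pi_ p y m j * L) + L)
      <= (-1) ^+ c * (hits R o y j b - mean_hits p y m j b))
  <= expR (- (3 * L)).
Proof.
move=> hp jm T0 L0; set P := T%:R * _; set a := 7 * _.
have P0 : 0 <= P by rewrite mulr_ge0 ?pi_ge0.
have [l /andP[l0 l2] hl] := chernoff_rate L0 P0; rewrite -/a in hl.
apply: (@le_trans _ _ (Prob p (fun o : {ffun 'I_T -> 'I_m.+1} =>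
    l * a <= ((-1) ^+ c * l) * (hits R o y j b - mean_hits p y m j b)))).
  by apply: le_Prob => o; rewrite [_ * l]mulrC -mulrA ler_pM2l.
apply: le_trans (hits_tail _ _ _ hp jm _) _.
  by case: c; rewrite ?expr0 ?expr1; lra.
rewrite ler_expR exprMn sqrr_sign mul1r.
have : 2 * l ^+ 2 * mean_hits p y m j b <= 2 * l ^+ 2 * P.
  by rewrite ler_wpM2l ?mean_hits_le // mulr_ge0 ?sqr_ge0.
lra.
Qed.

Lemma bias_meanE (R : realType) T (p : 'I_T -> R) y v m j :
  bias p y v m j = T%:R^-1 *
    ((1 - v) * mean_hits p y m j true - v * mean_hits p y m j false).
Proof.
rewrite /bias /Emp /mean_hits !mulr_sumr -sumrB mulr_sumr; apply: eq_bigr => t _.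
by case: (y t) => /=; ring.
Qed.

Lemma bias_roundedE (R : realType) T m (o : {ffun 'I_T -> 'I_m.+1}) y (v : R) j :
  (0 < m)%N -> bias (rounded o) y v m j = T%:R^-1 *
    ((1 - v) * hits R o y j true - v * hits R o y j false).
Proof.
move=> m0; rewrite bias_meanE /mean_hits /hits; congr (_ * (_ * _ - _ * _));
  by apply: eq_bigr => t _; rewrite /rounded wgt_grid // -natrM mulnb.
Qed.

(** The deviations of the two label counts enter with weights [1 - v] and [v], which sum to 1, so
    the constant 7 survives for every [v]. *)
Lemma bias_rounded_close (R : realType) T m (p : 'I_T -> R) y
    (o : {ffun 'I_T -> 'I_m.+1}) (v L : R) j :
  (0 < m)%N -> (0 < T)%N -> 0 <= v <= 1 -> 0 <= L ->
  (forall b, `|hits R o y j b - mean_hits p y m j b|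
     <= 7 * (Num.sqrt (T%:R * pi_ p y m j * L) + L)) ->
  `|bias (rounded o) y v m j - bias p y v m j| <=
    7 * Num.sqrt (L / T%:R) * Num.sqrt (pi_ p y m j) + 7 * Num.sqrt (L / T%:R) ^+ 2.
Proof.
move=> m0 T0 /andP[v0 v1] L0 hb; have TR : 0 < T%:R :> R by rewrite ltr0n.
rewrite bias_roundedE // bias_meanE -mulrBr normrM ger0_norm ?invr_ge0 // mulrC.
rewrite ler_pdivrMr //.
have -> : (7 * Num.sqrt (L / T%:R) * Num.sqrt (pi_ p y m j) + 7 * Num.sqrt (L / T%:R) ^+ 2) * T%:R
   = 7 * (Num.sqrt (T%:R * pi_ p y m j * L) + L).
  have d0 : 0 <= L / T%:R by rewrite divr_ge0.
  rewrite sqr_sqrtr //.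
  have -> : T%:R * pi_ p y m j * L = (L / T%:R * pi_ p y m j) * T%:R ^+ 2.
    by field; rewrite lt0r_neq0.
  rewrite [Num.sqrt (_ * T%:R ^+ 2)]sqrtrM; last exact: mulr_ge0 d0 (pi_ge0 p y m j).
  rewrite sqrtr_sqr ger0_norm // [Num.sqrt (_ * pi_ _ _ _ _)]sqrtrM //.
  by field; rewrite lt0r_neq0.
have := hb true; have := hb false; rewrite !ler_norml => /andP[f1 f2] /andP[t1 t2].
set W := 7 * _ in f1 f2 t1 t2 *.
set x := _ - _ in f1 f2; set z := _ - _ in t1 t2.
rewrite (_ : _ - _ - (_ - _) = (1 - v) * z - v * x); last by rewrite /z /x; ring.
have g1 := ler_wpM2l v0 f1; have g2 := ler_wpM2l v0 f2.
have v' : 0 <= 1 - v by lra.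
have g3 := ler_wpM2l v' t1; have g4 := ler_wpM2l v' t2.
by apply/andP; split; lra.
Qed.

(** * Comparing the losses before and after rounding *)

(** The cells on one side of a cutoff need not fill whole dyadic blocks, so the sequences are
    extended by zero past [n]. *)
Lemma side_deviation (R : realType) (k n : nat) (eps : R) (pr mu X : nat -> R) :
  (n <= 2 ^ k)%N -> 0 <= eps -> eps * (2 ^ k)%:R <= 1 ->
  (forall d, 0 <= pr d) ->
  (forall d, (0 < d <= n)%N -> X d <= mu d + 7 * eps * Num.sqrt (pr d) + 7 * eps ^+ 2) ->
  \sum_(1 <= d < n.+1) pr d <= 1 ->
  (forall D, (0 < D <= n)%N -> \sum_(D <= d < n.+1)
    posp (mu d + pr d * ((D%:R - 1) / (2 ^ k)%:R)) <= 2 / (2 ^ k)%:R) ->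
  \sum_(1 <= d < n.+1) posp (X d) <=
  \sum_(1 <= d < n.+1) posp (mu d) + 88 * eps * k.+1%:R.
Proof.
move=> nk e0 em pr0 hX hpr hbad.
pose tr (f : nat -> R) d := if (0 < d <= n)%N then f d else 0.
have k2 : (2 ^ k < 2 ^ k.+1)%N by rewrite ltn_exp2l.
have trE (f : nat -> R) D M : (0 < D <= n.+1)%N -> (n < M)%N ->
    \sum_(D <= d < M) tr f d = \sum_(D <= d < n.+1) f d.
  move=> /andP[D0 Dn] nM; rewrite (@big_cat_nat _ _ _ n.+1) //=.
  rewrite [X in _ + X]big_nat [X in _ + X]big1 ?addr0.
    by apply: eq_big_nat => d hd; rewrite /tr ifT //; lia.
  by move=> d hd; rewrite /tr ifF //; lia.
have tr_le (f : nat -> R) D M : (forall d, 0 <= f d) -> (0 < D)%N -> (D <= M)%N ->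
    \sum_(D <= d < M) tr f d <= if (D <= n)%N then \sum_(D <= d < n.+1) f d else 0.
  move=> f0 D0 DM; case: leqP => [Dn|nD]; last first.
    by rewrite big_nat big1 // => d hd; rewrite /tr ifF //; lia.
  rewrite -(@trE _ _ (M + n.+1)) //; [|lia|lia].
  rewrite [X in _ <= X](@big_cat_nat _ _ _ M) //=; last by lia.
  by rewrite lerDl sumr_ge0 // => d _; rewrite /tr; case: ifP.
have tr_posp f d : posp (tr f d) = tr (fun d => posp (f d)) d.
  by rewrite /tr; case: ifP => // _; rewrite posp_id.
have := @dyadic_deviation R k eps (tr pr) (tr mu) (tr X) e0 em.
under eq_bigr => d _ do rewrite tr_posp.
under [X in _ <= X + _]eq_bigr => d _ do rewrite tr_posp.
rewrite !trE //; try lia; apply.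
- by move=> d; rewrite /tr; case: ifP.
- move=> d; rewrite /tr; case: ifP => [/hX //|_].
  by rewrite sqrtr0 mulr0 !add0r mulr_ge0 ?sqr_ge0.
- move=> a ak; have a0 : (0 < 2 ^ a)%N by rewrite expn_gt0.
  apply: le_trans (tr_le _ _ _ pr0 a0 _) _; first by rewrite leq_exp2l.
  case: leqP => // an; apply: le_trans hpr.
  rewrite [X in _ <= X](@big_cat_nat _ _ _ (2 ^ a)) //=; last by lia.
  by rewrite lerDr sumr_ge0.
move=> a ak; have a0 : (0 < 2 ^ a)%N by rewrite expn_gt0.
have c0 : 0 <= 2 / (2 ^ k)%:R :> R by rewrite divr_ge0.
rewrite (eq_bigr (tr (fun d => posp (mu d + pr d * (((2 ^ a)%:R - 1) / (2 ^ k)%:R))))).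
  apply: le_trans (tr_le _ _ _ _ a0 _) _; [by move=> d; exact: posp_ge0|by rewrite leq_exp2l|].
  by case: leqP => // an; apply: hbad; rewrite a0.
by move=> d _; rewrite /tr; case: ifP => // _; rewrite mul0r addr0 posp_id.
Qed.

Lemma sum_reflect (R : realType) (F : nat -> R) D n : (D <= n.+1)%N ->
  \sum_(D <= d < n.+1) F (n - d)%N = \sum_(0 <= j < n.+1 - D) F j.
Proof.
move=> Dn; rewrite -{1}[D]add0n big_addn [RHS]big_nat_rev /=.
by apply: eq_big_nat => d hd; congr F; lia.
Qed.

Lemma sum_shift (R : realType) (F : nat -> R) D i m :
  \sum_(D <= d < (m - i).+1) F (i + d)%N = \sum_(i + D <= j < (m - i).+1 + i) F j.
Proof.
rewrite [(i + D)%N]addnC big_addn addnK.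
by apply: eq_bigr => d _; rewrite addnC.
Qed.

Lemma sum_pi_le (R : realType) T (p : 'I_T -> R) y m a b : (0 < T)%N ->
  (forall t, 0 <= p t <= 1) -> (a <= b <= m.+1)%N -> \sum_(a <= j < b) pi_ p y m j <= 1.
Proof.
move=> T0 hp ab; rewrite -[X in _ <= X](sum_pi y m T0 hp).
by apply: subsum_le => // i _; exact: pi_ge0.
Qed.

Lemma cutoff_loss_deviation (R : realType) T (p p' : 'I_T -> R) y (k i : nat) (eps : R) :
  (0 < T)%N -> (forall t, 0 <= p t <= 1) -> (i < 2 ^ k)%N ->
  0 <= eps -> eps * (2 ^ k)%:R <= 1 -> SCDLm p y (2 ^ k)%N <= 2 / (2 ^ k)%:R ->
  (forall j v, (j <= 2 ^ k)%N -> 0 <= v <= 1 ->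
    `|bias p' y v (2 ^ k)%N j - bias p y v (2 ^ k)%N j|
      <= 7 * eps * Num.sqrt (pi_ p y (2 ^ k)%N j) + 7 * eps ^+ 2) ->
  cutoff_loss p' y (2 ^ k)%N i <= cutoff_loss p y (2 ^ k)%N i + 176 * eps * k.+1%:R.
Proof.
move=> T0 hp; set m := (2 ^ k)%N => im e0 em hS dev.
have m0 : (0 < m)%N by rewrite expn_gt0.
have mR : 0 < m%:R :> R by rewrite ltr0n.
have hv := grid_itv R m0 im; have hu := grid_itv R m0 (ltnW im).
have loss i' : (i' <= m)%N -> cutoff_loss p y m i' <= 2 / m%:R.
  by move=> h; apply: le_trans hS; exact: cutoff_loss_le.
have sum0 (F : nat -> R) a b : 0 <= \sum_(a <= j < b) posp (F j).
  by apply: sumr_ge0 => j _; exact: posp_ge0.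
have side := @side_deviation R k; rewrite -/m in em side *; clearbody m.
have low : \sum_(0 <= j < i.+1) posp (bias p' y (i.+1%:R / m%:R) m j) <=
    \sum_(0 <= j < i.+1) posp (bias p y (i.+1%:R / m%:R) m j) + 88 * eps * k.+1%:R.
  set v := i.+1%:R / m%:R in hv *.
  (* Below the cutoff, distance is measured down from [i+1], so that every cell has [d >= 1]. *)
  have := side i.+1 eps (fun d => pi_ p y m (i.+1 - d))
    (fun d => bias p y v m (i.+1 - d)) (fun d => bias p' y v m (i.+1 - d)).
  rewrite (@sum_reflect _ (fun j => posp (bias p' y v m j))) //.
  rewrite (@sum_reflect _ (fun j => posp (bias p y v m j))) //.
  rewrite (@sum_reflect _ (pi_ p y m)) // subn1 /=; apply => //.
  - by move=> d; exact: pi_ge0.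
  - move=> d /andP[d0 di]; have /(dev _ v) : (i.+1 - d <= m)%N by clear -im d0 di; lia.
    by move=> /(_ hv); rewrite ler_norml => /andP[_]; lra.
  - by apply: sum_pi_le => //; clear -im; lia.
  move=> D /andP[D0 Di].
  rewrite (@sum_reflect _ (fun j => posp (bias p y v m j + pi_ p y m j * ((D%:R - 1) / m%:R))));
    last by clear -im D0 Di; lia.
  (* Lowering the threshold [(i+1)/m] by [(D-1)/m] gives the lower threshold of cutoff [i+1-D],
     whose lower cells are exactly those at distance at least [D]. *)
  apply: le_trans (loss (i.+1 - D)%N _); last by clear -im D0 Di; lia.
  rewrite /cutoff_loss -subSn // -[X in X <= _]addr0 lerD //.
  rewrite le_eqVlt; apply/orP; left; apply/eqP; apply: eq_bigr => j _; congr posp.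
  rewrite [RHS](bias_shift _ _ _ _ _ v); congr (_ + _ * _).
  by rewrite /v natrB; [rewrite -natr1; field; rewrite lt0r_neq0 | clear -im D0 Di; lia].
have high : \sum_(i.+1 <= j < m.+1) posp (- bias p' y (i%:R / m%:R) m j) <=
    \sum_(i.+1 <= j < m.+1) posp (- bias p y (i%:R / m%:R) m j) + 88 * eps * k.+1%:R.
  set u := i%:R / m%:R in hu *.
  have E : ((m - i).+1 + i = m.+1)%N by clear -im; lia.
  have := side (m - i)%N eps (fun d => pi_ p y m (i + d))
    (fun d => - bias p y u m (i + d)) (fun d => - bias p' y u m (i + d)).
  rewrite (@sum_shift _ (fun j => posp (- bias p' y u m j))).
  rewrite (@sum_shift _ (fun j => posp (- bias p y u m j))).
  rewrite (@sum_shift _ (pi_ p y m)) addn1 E; apply => //.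
  - exact: leq_subr.
  - by move=> d; exact: pi_ge0.
  - move=> d /andP[d0 di]; have /(dev _ u) : (i + d <= m)%N by clear -im d0 di; lia.
    by move=> /(_ hu); rewrite ler_norml => /andP[+ _]; lra.
  - by apply: sum_pi_le => //; clear -im; lia.
  move=> D /andP[D0 Di].
  rewrite (@sum_shift _ (fun j => posp (- bias p y u m j + pi_ p y m j * ((D%:R - 1) / m%:R)))) E.
  (* Symmetrically, the upper threshold of cutoff [i+D-1] is [i/m + (D-1)/m], and its upper cells
     start at [i+D]. *)
  apply: le_trans (loss (i + D).-1%N _); last by clear -im D0 Di; lia.
  rewrite /cutoff_loss prednK; last by clear -im D0 Di; lia.
  rewrite -[X in X <= _]add0r lerD //.
  rewrite le_eqVlt; apply/orP; left; apply/eqP; apply: eq_bigr => j _; congr posp.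
  rewrite [in RHS](bias_shift _ _ _ _ _ u) opprD; congr (_ + _); rewrite -mulrN; congr (_ * _).
  have -> : (i + D).-1%:R = i%:R + D%:R - 1 :> R.
    have : ((i + D).-1.+1 = i + D)%N by clear -im D0 Di; lia.
    by move/(congr1 (fun n => n%:R : R)); rewrite natrD -natr1; lra.
  by rewrite /u; field; rewrite lt0r_neq0.
by rewrite /cutoff_loss; lra.
Qed.

Lemma SCDLm_deviation (R : realType) T (p p' : 'I_T -> R) y (k : nat) (eps : R) :
  (0 < T)%N -> (forall t, 0 <= p t <= 1) ->
  0 <= eps -> eps * (2 ^ k)%:R <= 1 -> SCDLm p y (2 ^ k)%N <= 2 / (2 ^ k)%:R ->
  (forall j v, (j <= 2 ^ k)%N -> 0 <= v <= 1 ->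
    `|bias p' y v (2 ^ k)%N j - bias p y v (2 ^ k)%N j|
      <= 7 * eps * Num.sqrt (pi_ p y (2 ^ k)%N j) + 7 * eps ^+ 2) ->
  SCDLm p' y (2 ^ k)%N <= SCDLm p y (2 ^ k)%N + 176 * eps * k.+1%:R.
Proof.
move=> T0 hp e0 em hS dev.
have S0 : 0 <= SCDLm p y (2 ^ k)%N by rewrite SCDLmE; apply: bigmax_ge_id.
have c0 : 0 <= 176 * eps * k.+1%:R by rewrite !mulr_ge0.
have z0 := addr_ge0 S0 c0.
rewrite [X in X <= _]SCDLmE; apply: bigmax_le => // i _.
have := ltn_ord i; rewrite ltnS leq_eqVlt => /predU1P[->|im].
  by rewrite cutoff_loss_last // expn_gt0.
apply: le_trans (cutoff_loss_deviation T0 hp im e0 em hS dev) _.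
by rewrite lerD2r cutoff_loss_le // ltnW.
Qed.

(** Turns the number of scales into [log m]: [ln 2 >= 1/2] and [k + 1 <= 2k]. *)
Lemma ln_pow2_ge (R : realType) (k : nat) : (0 < k)%N ->
  k.+1%:R <= 4 * ln (2 ^ k)%:R :> R.
Proof.
move=> k0; have ln2 : 1 / 2 <= ln 2 :> R.
  have : ln (1 + - (1 / 2)) <= - (1 / 2) :> R by apply: le_ln1Dx; lra.
  rewrite (_ : 1 + - (1 / 2) = 2^-1); last by lra.
  by rewrite lnV ?posrE //; lra.
rewrite natrX lnXn // -[ln 2 *+ k]mulr_natr.
have k1 : 1 <= k%:R :> R by rewrite ler1n.
have := ler_wpM2r (ler0n R k) ln2; rewrite -[k.+1%:R]natr1; lra.
Qed.

Theorem theorem4p8 :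
  exists C1 C2 : Rdefinitions.R, 0 < C1 /\ 0 < C2 /\
  forall (T : nat) (p : 'I_T -> Rdefinitions.R) (y : 'I_T -> bool) (k : nat),
    (0 < T)%N -> (forall t, 0 <= p t <= 1) -> (0 < k)%N ->
    SCDL p y < 2 / (2 ^ k)%:R ->
    forall delta : Rdefinitions.R,
      0 < delta -> delta < (2 * (2 ^ k)%:R)^-1 ->
      C1 * Num.sqrt (ln delta^-1 / T%:R) <= ((2 ^ k)%:R)^-1 ->
      1 - delta <=
      Prob (m := (2 ^ k)%N) p (fun o =>
        forall (A : Type) (U : A -> bool -> Rdefinitions.R) (r : Rdefinitions.R -> A),
          utility_ok U -> best_response U r ->
          SR U r (rounded o) y <=
            2 * SCDL p y + 2 / (2 ^ k)%:R
            + C2 * Num.sqrt (ln delta^-1 / T%:R) * ln (2 ^ k)%:R).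
Proof.
(* [C1 = 1] yields [eps * m <= 1]. [C2 = 2 * 176 * 4]: the factor 2 from [SR_le_SCDLm], 176 from the
   two sides of a cutoff, 4 from [ln_pow2_ge]. *)
exists 1, 1408; do 2 split=> //.
move=> T p y k T0 hp k0 hS delta d0 dm; rewrite mul1r => he.
have mN : (0 < 2 ^ k)%N by rewrite expn_gt0.
have m2 : (2 <= 2 ^ k)%N by rewrite -{1}(expn1 2) leq_exp2l.
have mR : 0 < (2 ^ k)%:R :> Rdefinitions.R by rewrite ltr0n.
have m2R : 2 <= (2 ^ k)%:R :> Rdefinitions.R by rewrite ler_nat.
set m := (2 ^ k)%N in mN m2 mR m2R dm he hS *.
have mdelta : delta * (2 * m%:R) < 1 by rewrite -ltr_pdivlMr ?mulr_gt0 // mul1r.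
set L := ln delta^-1 in he *.
have L0 : 0 < L.
  rewrite ln_gt0 // -[X in X < _]invr1 ltf_pV2 ?posrE //.
  apply: le_lt_trans mdelta; rewrite -[X in X <= _]mulr1 ler_wpM2l ?ltW //; lra.
set eps := Num.sqrt _ in he *.
have e0 : 0 <= eps by exact: sqrtr_ge0.
have em : eps * m%:R <= 1 by rewrite -ler_pdivlMr // mul1r.
have SS := SCDLm_le_SCDL hp k0 hS.
(* This event mentions only cells and labels, so it handles all decision tasks simultaneously. *)
pose good (o : {ffun 'I_T -> 'I_m.+1}) := forall (j : 'I_m.+1) b,
  `|hits _ o y j b - mean_hits p y m j b| <= 7 * (Num.sqrt (T%:R * pi_ p y m j * L) + L).
apply: (@le_trans _ _ (Prob p good)); last first.
  apply: le_Prob => o Go A U r hU hr.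
  apply: (le_trans (SR_le_SCDLm o y hU hr mN T0)).
  have : SCDLm (rounded o : 'I_T -> Rdefinitions.R) y m <= SCDLm p y m + 176 * eps * k.+1%:R.
    apply: SCDLm_deviation => //.
      by apply: le_trans SS _; exact: ltW.
    move=> j v jm hv; apply: bias_rounded_close => //; first exact: ltW.
    by move=> b; exact: (Go (Ordinal (jm : (j < m.+1)%N)) b).
  have : 176 * eps * k.+1%:R <= 176 * eps * (4 * ln m%:R).
    by rewrite ler_wpM2l ?ln_pow2_ge // mulr_ge0.
  by rewrite -/m in SS *; lra.
rewrite (ProbC good hp) lerD2l lerN2.
pose bad (x : 'I_m.+1 * bool * bool) (o : {ffun 'I_T -> 'I_m.+1}) :=
  7 * (Num.sqrt (T%:R * pi_ p y m x.1.1 * L) + L)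
    <= (-1) ^+ x.2 * (hits _ o y x.1.1 x.1.2 - mean_hits p y m x.1.1 x.1.2).
apply: (@le_trans _ _ (Prob p (fun o => exists x, bad x o))).
  apply: le_Prob => o /existsNP[j /existsNP[b /negP]].
  rewrite -ltNge => /ltW; rewrite ler_normr => /orP[h|h].
    by exists (j, b, false); rewrite /bad expr0 mul1r.
  by exists (j, b, true); rewrite /bad expr1 mulN1r.
apply: le_trans (Prob_union _ _) _.
(* There are [4 (m + 1)] bad events (cell, label, tail). Since [4 (m + 1) <= (2m)^2] for [m >= 2]
   and [2m * delta < 1], the total is at most [delta]. *)
apply: (@le_trans _ _ (\sum_(x : 'I_m.+1 * bool * bool) delta ^+ 3)).
  apply: ler_sum => -[[j b] c] _.
  have jm : (j <= m)%N by rewrite -ltnS.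
  apply: le_trans (hits_deviation y b c hp jm T0 L0) _.
  by rewrite expRN expRM_natl lnK ?posrE ?invr_gt0 // exprVn invrK.
rewrite sumr_const !card_prod card_ord card_bool -[X in X <= _]mulr_natr !natrM -natr1.
have h : (m%:R + 1) * 4 <= (2 * m%:R) ^+ 2 :> Rdefinitions.R by nra.
have d2 : delta ^+ 2 * ((m%:R + 1) * 4) <= 1.
  apply: le_trans (ler_wpM2l (sqr_ge0 _) h) _.
  by rewrite -exprMn exprn_ile1 ?mulr_ge0 // ltW.
have := ler_wpM2l (ltW d0) d2; rewrite mulr1; lra.
Qed.
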